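(* Let $X=(x_k : k\in\mathbb{N})$ be a $\Re$-Leja sequence, and for $k\ge 1$ let $X_k=(x_0,\dots,x_{k-1})$. The Lebesgue constant $\Delta(X_k)$ for the interpolation points $x_0,\dots,x_{k-1}$ satisfies $$\Delta(X_k)=O(k^3\log k),\qquad k\to\infty .$$
   Context: $\mathbb{N}=\{0,1,2,\dots\}$. Let $D=\{z\in\mathbb{C}: |z|\le 1\}$. A Leja sequence (for $D$) is a sequence $E=(e_k: k\in\mathbb{N})$ of points of $D$ with $e_0=1$ and, for every $j\ge 1$, $\prod_{m=0}^{j-1}|e_j-e_m|=\max_{z\in D}\prod_{m=0}^{j-1}|z-e_m|$. A $\Re$-Leja sequence is a sequence $X=X(E)$ in $[-1,1]$ for which there is a Leja sequence $E=(e_k:k\in\mathbb{N})$ such that $X$ is obtained from the sequence of real parts $(\Re(e_k): k\in\mathbb{N})$ by eliminating repeated values (each value is kept only at its first occurrence, the order being preserved). For a finite set $A$ of points and $a\in A$, put $\ell(A,a;x)=\prod_{b\in A,\,b\ne a}\frac{x-b}{a-b}$. For $A\subset[-1,1]$, the Lebesgue constant is $\Delta(A)=\max_{x\in[-1,1]}\sum_{a\in A}|\ell(A,a;x)|$, i.e. the norm of the Lagrange interpolation operator $f\mapsto \sum_{a\in A} f(a)\ell(A,a;\cdot)$ on $C([-1,1])$. A tuple of distinct points is identified with its underlying set. *)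

(* Defs.v *)
From mathcomp Require Import all_boot all_order all_algebra.
From mathcomp Require Import finmap.
From mathcomp Require Import all_classical all_reals all_analysis.
From mathcomp Require Import complex.

Set Implicit Arguments.
Unset Strict Implicit.
Unset Printing Implicit Defensive.

Import Order.TTheory GRing.Theory Num.Theory.
Import numFieldTopology.Exports numFieldNormedType.Exports.

Local Open Scope classical_set_scope.
Local Open Scope ring_scope.
Local Open Scope complex_scope.

Definition unit_disk (R : realType) : set R[i] := [set z | `|z| <= 1].

Definition Leja (R : realType) (e : nat -> R[i]) : Prop :=
  [/\ forall j, unit_disk (e j),
      e 0%N = 1 &
      forall j : nat, (1 <= j)%N -> forall z, unit_disk z ->
        \prod_(m < j) `|z - e m| <= \prod_(m < j) `|e j - e m|].

(* [v] enumerates, in increasing order of index, the terms of [u] at those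
   indices where a value occurs for the first time.  ([undup] is unsuitable
   even for finite prefixes: it keeps last occurrences.) *)
Definition dedup_of (T : Type) (u v : nat -> T) : Prop :=
  exists n : nat -> nat,
    [/\ {homo n : i j / (i < j)%N},
        range n = [set k | forall j, (j < k)%N -> u j <> u k] &
        forall i, v i = u (n i)].

Definition ReLeja (R : realType) (x : nat -> R) : Prop :=
  exists2 e : nat -> R[i], Leja e & dedup_of (fun k => complex.Re (e k)) x.

Definition lagrange_fun (R : realType) (A : {fset R}) (a x : R) : R :=
  \prod_(b <- A | b != a) ((x - b) / (a - b)).

Definition lebesgue_fun (R : realType) (A : {fset R}) (x : R) : R :=
  \sum_(a <- A) `|lagrange_fun A a x|.

Definition lebesgue_constant (R : realType) (A : {fset R}) : R :=
  sup (lebesgue_fun A @` `[-1, 1]).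

Lemma continuous_lebesgue_fun (R : realType) (A : {fset R}) :
  continuous (lebesgue_fun A).
Proof.
have cprod (s : seq R) a :
    continuous (fun x : R => \prod_(b <- s | b != a) ((x - b) / (a - b))).
  elim: s => [|b s IH] x.
    by under eq_fun do rewrite big_nil; exact: cvg_cst.
  under eq_fun do rewrite big_cons; case: ifP => _; last exact: IH.
  apply: cvgM; last exact: IH.
  by apply: cvgMl; apply: cvgB; [exact: cvg_id|exact: cvg_cst].
rewrite /lebesgue_fun; elim: (enum_fset A) => [|a s IH] x.
  by under eq_fun do rewrite big_nil; exact: cvg_cst.
under eq_fun do rewrite big_cons; apply: cvgD; last exact: IH.
by apply: cvg_norm; exact: cprod.
Qed.

(* The supremum is a maximum, as in the usual definition. *)
Lemma lebesgue_constant_max (R : realType) (A : {fset R}) :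
  exists2 c, c \in `[-1, 1]%R & lebesgue_fun A c = lebesgue_constant A /\
    forall x, x \in `[-1, 1]%R -> lebesgue_fun A x <= lebesgue_constant A.
Proof.
have [c cI cmax] : exists2 c, c \in `[-1, 1]%R &
    forall t, t \in `[-1, 1]%R -> lebesgue_fun A t <= lebesgue_fun A c.
  apply: EVT_max; first exact: le_trans (lerN10 R) ler01.
  exact/continuous_subspaceT/continuous_lebesgue_fun.
have ub : ubound (lebesgue_fun A @` `[-1, 1]) (lebesgue_fun A c).
  by move=> _ [t /= tI <-]; exact: cmax.
have E : lebesgue_fun A c = lebesgue_constant A.
  apply/eqP; rewrite eq_le; apply/andP; split.
    by apply: ub_le_sup; [exists (lebesgue_fun A c)|exists c].
  by apply: ge_sup => //; exists (lebesgue_fun A c); exists c.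
by exists c => //; split=> // x xI; rewrite -E cmax.
Qed.

Definition first_points (R : realType) (x : nat -> R) (k : nat) : {fset R} :=
  [fset x (val i) | i : 'I_k]%fset.

(* Main.v *)
(* A Leja sequence [e] has a dyadic structure: the terms with index
   in [q 2^n, (q+1) 2^n) are the roots of z^(2^n) = e_(q 2^n)^(2^n), and the two
   halves of such a block are opposite at the level of 2^(n-1)-th powers.  So,
   with N = 2^n, the first k = N + 1 + j (j < N) points of [x] are the real
   parts of all 2N-th roots of unity and of the first j points of the block
   g_m = e_(2N+m), m < N, which satisfy g_m^N = c with c^2 = -1.
   For X = Re z and |z| = |b| = 1, 2 |X - Re b| = |z - b| |z^* - b|, so each
   Lagrange polynomial is a quotient of products over points of the circle.  Its
   denominator is bounded below by completing the nodes to those of the next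
   level (j = N), where the product is explicit.  What remains are products
   prod_(m<j) |z - g_m| * prod_(j<=m<N) |w - g_m|, which are at most 2N by
   induction on n.  Each Lagrange polynomial is thus at most (2N)^2, and the
   Lebesgue constant is at most 4 k^3. *)
Require Import Defs.
From mathcomp Require Import all_boot all_order all_algebra.
From mathcomp Require Import finmap.
From mathcomp Require Import all_classical all_reals all_analysis.
From mathcomp Require Import complex ring lra zify.

Set Implicit Arguments.
Unset Strict Implicit.
Unset Printing Implicit Defensive.

Import Order.TTheory GRing.Theory Num.Theory.
Import numFieldTopology.Exports numFieldNormedType.Exports.

Local Open Scope classical_set_scope.
Local Open Scope ring_scope.
Local Open Scope complex_scope.

(* Otherwise [^*] is [Num.conj] wherever [ring_scope] comes first. *)
Local Notation "z ^*" := (conjc z) : ring_scope.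

(** * Index shifts and a real-valued modulus *)

Lemma big_nat_shiftl (T : Type) (idx : T) (op : T -> T -> T) a b r
    (P : pred nat) (F : nat -> T) : (a <= b)%N ->
  \big[op/idx]_(b <= m < r | P m) F m =
  \big[op/idx]_(b - a <= m < r - a | P (a + m)%N) F (a + m)%N.
Proof.
move=> ab; rewrite -{1}(subnK ab) big_addn.
by apply: eq_big => m; rewrite addnC.
Qed.

Lemma big_nat_shift (T : Type) (idx : T) (op : T -> T -> T) a r
    (P : pred nat) (F : nat -> T) :
  \big[op/idx]_(a <= m < r | P m) F m =
  \big[op/idx]_(0 <= m < r - a | P (a + m)%N) F (a + m)%N.
Proof. by rewrite (big_nat_shiftl _ _ _ _ _ (leqnn a)) subnn. Qed.

(** The norm of [R[i]] takes its values in [R[i]]; its real part carries the same information and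
    allows real inequalities and real arithmetic. *)
Definition modulus (R : realType) (z : R[i]) : R := complex.Re `|z|.

Lemma modulusE (R : realType) (z : R[i]) : (modulus z)%:C = `|z|.
Proof. by case: z. Qed.

Lemma modulus_ge0 (R : realType) (z : R[i]) : 0 <= modulus z.
Proof. by rewrite -lecR modulusE normr_ge0. Qed.

Lemma modulusM (R : realType) (z w : R[i]) :
  modulus (z * w) = modulus z * modulus w.
Proof. by apply: complexI; rewrite rmorphM /= !modulusE normrM. Qed.

Lemma modulusX (R : realType) (z : R[i]) n : modulus (z ^+ n) = modulus z ^+ n.
Proof. by apply: complexI; rewrite rmorphXn /= !modulusE normrX. Qed.

Lemma modulusN (R : realType) (z : R[i]) : modulus (- z) = modulus z.
Proof. by apply: complexI; rewrite !modulusE normrN. Qed.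

Lemma modulusJ (R : realType) (z : R[i]) : modulus z^* = modulus z.
Proof. by apply: complexI; rewrite !modulusE normcJ. Qed.

Lemma modulus_prod (R : realType) I (s : seq I) (P : pred I) (F : I -> R[i]) :
  modulus (\prod_(i <- s | P i) F i) = \prod_(i <- s | P i) modulus (F i).
Proof.
apply: complexI; rewrite rmorph_prod modulusE normr_prod.
by apply: eq_bigr => i _; rewrite -modulusE.
Qed.

Lemma modulusD (R : realType) (z w : R[i]) :
  modulus (z + w) <= modulus z + modulus w.
Proof. by rewrite -lecR rmorphD /= !modulusE ler_normD. Qed.

Lemma modulusBC (R : realType) (z w : R[i]) : modulus (z - w) = modulus (w - z).
Proof. by rewrite -modulusN opprB. Qed.

Lemma modulusB (R : realType) (z w : R[i]) :
  modulus (z - w) <= modulus z + modulus w.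
Proof. by rewrite (le_trans (modulusD _ _))// modulusN. Qed.

Lemma modulus_eq0 (R : realType) (z : R[i]) : (modulus z == 0) = (z == 0).
Proof. by rewrite -(inj_eq (@complexI _)) modulusE normr_eq0. Qed.

Lemma modulus_nat (R : realType) n : modulus (n%:R : R[i]) = n%:R.
Proof. by apply: complexI; rewrite modulusE normr_nat rmorph_nat. Qed.

Lemma two_modulus (R : realType) (c : R[i]) :
  modulus c = 1 -> modulus (c + c) = 2.
Proof.
by move=> c1; rewrite -mulr2n -[c *+ 2]mulr_natl modulusM c1 modulus_nat mulr1.
Qed.

Lemma mulJ_unit (R : realType) (z : R[i]) : modulus z = 1 -> z * z^* = 1.
Proof. by move=> z1; rewrite -sqr_normc -modulusE z1 expr1n. Qed.

(* Strict convexity of the disk: the diameter from [w] ends at [- w]. *)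
Lemma modulusB_eq2 (R : realType) (z w : R[i]) :
  modulus z <= 1 -> modulus w = 1 -> 2 <= modulus (z - w) -> z = - w.
Proof.
move=> z1 w1 zw; apply/eqP; rewrite -subr_eq0 opprK.
have sq (u : R[i]) : (modulus u ^+ 2)%:C = u * u^*.
  by rewrite rmorphXn /= modulusE sqr_normc.
(* Parallelogram law: the hypotheses make the right-hand side at most 4 and the second square at
   least 4, so that the first square vanishes. *)
have para : modulus (z + w) ^+ 2 + modulus (z - w) ^+ 2
            = 2 * modulus z ^+ 2 + 2 * modulus w ^+ 2.
  apply: complexI.
  rewrite !rmorphD !(rmorphM _ 2) !rmorph_nat /= !sq !rmorphD !rmorphN /=.
  by ring.
rewrite -modulus_eq0 -sqrf_eq0 eq_le sqr_ge0 andbT.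
move: para (modulus_ge0 z) (modulus_ge0 (z - w)); rewrite w1.
by nra.
Qed.

(** * The dyadic structure of Leja sequences *)

(* The first [r] terms of [f], where [r <= 2 ^ n], form an initial part of a
   block of [2 ^ n] points of the circle whose halves, recursively, are opposite
   at the level of [2 ^ n]-th powers. *)
Fixpoint dyadic (R : realType) (n : nat) (f : nat -> R[i]) (r : nat) : Prop :=
  if n is n'.+1 then
    dyadic n' f (minn r (2 ^ n')) /\
    ((2 ^ n' < r)%N -> f (2 ^ n')%N ^+ (2 ^ n') = - f 0%N ^+ (2 ^ n') /\
                       dyadic n' (fun m => f (2 ^ n' + m)%N) (r - 2 ^ n'))
  else (0 < r)%N -> modulus (f 0%N) = 1.

Definition block (R : realType) (n : nat) (f : nat -> R[i]) : Prop :=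
  dyadic n f (2 ^ n).

Lemma blockS (R : realType) n (f : nat -> R[i]) :
  block n.+1 f <->
  [/\ block n f, block n (fun m => f (2 ^ n + m)%N) &
      f (2 ^ n)%N ^+ (2 ^ n) = - f 0%N ^+ (2 ^ n)].
Proof.
rewrite /block /=.
have -> : minn (2 ^ n.+1) (2 ^ n) = (2 ^ n)%N by rewrite expnS; lia.
have -> : (2 ^ n.+1 - 2 ^ n = 2 ^ n)%N by rewrite expnS; lia.
have -> : (2 ^ n < 2 ^ n.+1)%N by rewrite ltn_exp2l.
split; first by case=> ? /(_ isT) [].
by case.
Qed.

Lemma dyadic0 (R : realType) n (f : nat -> R[i]) : dyadic n f 0.
Proof. by elim: n f => //= n IH f; rewrite min0n. Qed.

Lemma dyadic_modulus0 (R : realType) n (f : nat -> R[i]) r :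
  dyadic n f r -> (0 < r)%N -> modulus (f 0%N) = 1.
Proof.
elim: n f r => //= n IH f r [+ _] r0; move=> /IH; apply.
by rewrite leq_min r0 expn_gt0.
Qed.

(** A block lists all roots of z^(2^n) = (f 0)^(2^n). At the next level, with u = z^(2^n) and a = (f
    0)^(2^n), the halves contribute u - a and u + a, whose product is u^2 - a^2. *)
Lemma prod_block (R : realType) n (f : nat -> R[i]) z : block n f ->
  \prod_(0 <= m < 2 ^ n) (z - f m) = z ^+ (2 ^ n) - f 0%N ^+ (2 ^ n).
Proof.
elim: n f => [|n IH] f; first by rewrite big_nat1 !expr1.
move=> /blockS [fn gn opp].
rewrite (@big_cat_nat _ _ _ (2 ^ n))//=; last by rewrite leq_exp2l.
rewrite (big_nat_shift _ _ (2 ^ n)) expnS mul2n -addnn addnK.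
rewrite (IH _ fn) (IH _ gn) addn0 opp !exprD.
by ring.
Qed.

Lemma expr_double (R : pzSemiRingType) (z : R) n :
  z ^+ (2 ^ n.+1) = z ^+ (2 ^ n) ^+ 2.
Proof. by rewrite -exprM expnSr. Qed.

Lemma sqrtC_unit (R : realType) (c : R[i]) : modulus c = 1 ->
  exists2 z, modulus z = 1 & z ^+ 2 = c.
Proof.
move=> c1; exists (sqrtC c); last by rewrite sqrtCK.
have := modulusX (sqrtC c) 2; rewrite sqrtCK c1 => /esym/eqP.
by rewrite sqrf_eq1 => /orP[/eqP//|/eqP e]; have := modulus_ge0 (sqrtC c); lra.
Qed.

Lemma modulusX_le1 (R : realType) (z : R[i]) n :
  modulus z <= 1 -> modulus (z ^+ n) <= 1.
Proof. by move=> z1; rewrite modulusX exprn_ile1// modulus_ge0. Qed.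

Lemma modulusX_unit (R : realType) (z : R[i]) n :
  modulus z = 1 -> modulus (z ^+ n) = 1.
Proof. by move=> z1; rewrite modulusX z1 expr1n. Qed.

(* All factors of the product can be maximal at the same time, so that a
   maximizer maximizes each of them; hence it extends the dyadic structure. *)
Lemma dyadic_maximizer (R : realType) n (f : nat -> R[i]) r :
  (r < 2 ^ n)%N -> dyadic n f r ->
  exists B : R, [/\ 0 < B,
    forall z, modulus z <= 1 -> \prod_(0 <= m < r) modulus (z - f m) <= B,
    forall c, modulus c = 1 -> ((0 < r)%N -> c = f 0%N ^+ (2 ^ n)) ->
      exists z, [/\ modulus z = 1, z ^+ (2 ^ n) = c &
        \prod_(0 <= m < r) modulus (z - f m) = B] &
    modulus (f r) <= 1 -> (r = 0%N -> modulus (f r) = 1) ->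
    B <= \prod_(0 <= m < r) modulus (f r - f m) ->
      [/\ modulus (f r) = 1, f r ^+ (2 ^ n) = f 0%N ^+ (2 ^ n) &
          dyadic n f r.+1]].
Proof.
elim: n f r => [|n IH] f r.
  rewrite expn0 ltnS leqn0 => /eqP-> _; exists 1; split=> //.
  - by move=> z _; rewrite big_nil.
  - by move=> c c1 _; exists c; rewrite big_nil expr1.
  - by move=> _ /(_ erefl) f1 _; split=> /=.
move=> rn [fr gr].
have [r_lt|r_ge] := ltnP r (2 ^ n).
  move: fr; rewrite (minn_idPl (ltnW r_lt)) => fr.
  have [B [B0 ub ex mx]] := IH f r r_lt fr.
  exists B; split=> //.
  - move=> c c1 cf.
    (* One level down, the prescribed power must be a square root of [c]: any one if [r = 0], and
       otherwise the one dictated by [f 0]. *)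
    have [c' [c'1 c'2 c'f]] : exists c', [/\ modulus c' = 1, c' ^+ 2 = c &
        ((0 < r)%N -> c' = f 0%N ^+ (2 ^ n))].
      case: (posnP r) => [r0|r0].
        by have [w w1 w2] := sqrtC_unit c1; exists w; split.
      exists (f 0%N ^+ (2 ^ n)); split=> //.
        by rewrite modulusX_unit// (dyadic_modulus0 fr).
      by rewrite -expr_double cf.
    have [z [z1 zc zB]] := ex c' c'1 c'f.
    by exists z; split=> //; rewrite expr_double zc.
  - move=> f1 f0 fB; have [e1 e2 e3] := mx f1 f0 fB.
    split=> //; first by rewrite !expr_double e2.
    by split; [rewrite (minn_idPl _)|lia].
rewrite (minn_idPr r_ge) in fr.
set g := fun m => f (2 ^ n + m)%N.
have r0 : (0 < r)%N by rewrite (leq_trans _ r_ge)// expn_gt0.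
have f01 : modulus (f 0%N) = 1 by apply: (dyadic_modulus0 fr); rewrite expn_gt0.
have gr' : dyadic n g (r - 2 ^ n).
  move: r_ge; rewrite leq_eqVlt => /orP[/eqP<-|/gr[]//].
  by rewrite subnn; exact: dyadic0.
have r'n : (r - 2 ^ n < 2 ^ n)%N by move: rn; rewrite expnS; lia.
have [B [B0 ub ex mx]] := IH g _ r'n gr'.
(* The first half is complete, so it collapses into one factor, at most 2 on the disk; the rest is a
   product over the start of the second half. *)
have split_prod z : \prod_(0 <= m < r) modulus (z - f m) =
    modulus (z ^+ (2 ^ n) - f 0%N ^+ (2 ^ n)) *
    \prod_(0 <= m < r - 2 ^ n) modulus (z - g m).
  rewrite (@big_cat_nat _ _ _ (2 ^ n))//= -modulus_prod prod_block//.
  by rewrite (big_nat_shift _ _ (2 ^ n)).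
have le2 z : modulus z <= 1 -> modulus (z ^+ (2 ^ n) - f 0%N ^+ (2 ^ n)) <= 2.
  move=> z1; apply: le_trans (modulusB _ _) _.
  by rewrite (modulusX_unit _ f01) -[2]/(1 + 1) lerD2r modulusX_le1.
exists (2 * B); split.
- by rewrite mulr_gt0.
- move=> z z1; rewrite split_prod ler_pM ?modulus_ge0 ?le2 ?ub//.
  by rewrite prodr_ge0// => m _; rewrite modulus_ge0.
(* A maximizer for the second half can be chosen with 2^n-th power opposite to that of [f 0], where
   the first factor is exactly 2. *)
- move=> c c1 /(_ r0) cf.
  have [||z [z1 zc zB]] := ex (- f 0%N ^+ (2 ^ n)).
  + by rewrite modulusN modulusX_unit.
  + by rewrite subn_gt0 => /gr[<- _]; rewrite /g addn0.
  exists z; split=> //; first by rewrite expr_double zc sqrrN -expr_double cf.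
  rewrite split_prod zB zc -opprD modulusN two_modulus//.
  exact: modulusX_unit.
- move=> fr1 _; rewrite split_prod => ge2B.
  have rE : (2 ^ n + (r - 2 ^ n) = r)%N by rewrite subnKC.
  have gE : g (r - 2 ^ n)%N = f r by rewrite /g rE.
  set a := modulus _ in ge2B; set b := \prod_(_ <= _ < _) _ in ge2B.
  have a2 : a <= 2 by apply: le2.
  have bB : b <= B by apply: ub.
  have a0 : 0 <= a by apply: modulus_ge0.
  have b0 : 0 <= b by apply: prodr_ge0 => m _; apply: modulus_ge0.
  (* From a <= 2, b <= B and 2 B <= a b, both factors must attain their bounds. *)
  have a_ge2 : 2 <= a by nra.
  have b_geB : B <= b by nra.
  have opp : f r ^+ (2 ^ n) = - f 0%N ^+ (2 ^ n).
    by apply: modulusB_eq2 => //; [exact: modulusX_le1|exact: modulusX_unit].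
  have fr_unit : modulus (f r) = 1.
    apply/eqP; rewrite -(@pexpr_eq1 _ _ (2 ^ n)%N) ?modulus_ge0 ?expn_gt0//.
    by rewrite -modulusX opp modulusN modulusX_unit.
  split=> //; first by rewrite !expr_double opp sqrrN.
  split; first by rewrite (minn_idPr _)// (leq_trans r_ge).
  move=> _; rewrite subSn//; split; last first.
    by have [] := mx; rewrite ?gE.
  (* The opposition of the halves is known once the second half has begun; if [f r] is its first
     point, it is [opp]. *)
  have [/gr[]//|r_le] := ltnP (2 ^ n) r.
  by have -> : f (2 ^ n)%N = f r by congr f; apply/eqP; rewrite eqn_leq r_ge.
Qed.

(** Induction on the number of terms: the maximizer given by [dyadic_maximizer] competes with [e r]
    in the Leja condition, so the product at [e r] attains the maximum and the structure extends. *)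
Lemma Leja_block (R : realType) (e : nat -> R[i]) n : Leja e -> block n e.
Proof.
case=> e1 e0 emax.
have eb m : modulus (e m) <= 1 by rewrite -lecR modulusE; exact: e1.
suff H r : (r <= 2 ^ n)%N -> dyadic n e r by exact: H.
elim: r => [|r IH] rn; first exact: dyadic0.
have [B [B0 ub ex mx]] := dyadic_maximizer rn (IH (ltnW rn)).
have e0m : modulus (e 0%N) = 1 by rewrite e0 (modulus_nat R 1).
have [||z [z1 _ zB]] := ex (e 0%N ^+ (2 ^ n)) => //.
  exact: modulusX_unit.
have [|||//] := mx; first exact: eb.
  by move->.
case: (posnP r) => [r0|r0].
  by rewrite -zB r0 !big_nil.
have := emax r r0 z; rewrite -zB !big_mkord.
rewrite -lecR !rmorph_prod => H.
under eq_bigr do rewrite /= modulusE.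
under [leRHS]eq_bigr do rewrite /= modulusE.
by apply: H; rewrite /unit_disk /= -modulusE z1.
Qed.

(** * Products over blocks *)

Lemma big_nat_neq_out (T : Type) (idx : T) (op : T -> T -> T) a b i
    (F : nat -> T) : ~~ (a <= i < b)%N ->
  \big[op/idx]_(a <= m < b | m != i) F m = \big[op/idx]_(a <= m < b) F m.
Proof.
move=> iab; rewrite [LHS]big_nat_cond [RHS]big_nat_cond.
by apply: eq_bigl => m; case: eqVneq iab => [->|_]; case: (a <= _ < b)%N.
Qed.

Lemma block_unit (R : realType) n (f : nat -> R[i]) m : block n f ->
  (m < 2 ^ n)%N -> modulus (f m) = 1.
Proof.
elim: n f m => [|n IH] f m; first by rewrite ltnS leqn0 => /(_ isT) f0 /eqP->.
move=> /blockS[fn gn _] mn; have [/(IH _ _ fn)//|m_ge] := ltnP m (2 ^ n).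
rewrite -(subnKC m_ge); apply: (IH _ _ gn).
by rewrite ltn_subLR// addnn -mul2n -expnS.
Qed.

Lemma block_exp (R : realType) n (f : nat -> R[i]) m : block n f ->
  (m < 2 ^ n)%N -> f m ^+ (2 ^ n) = f 0%N ^+ (2 ^ n).
Proof.
move=> fn mn; apply/eqP; rewrite -subr_eq0 -prod_block//.
by rewrite prodf_seq_eq0; apply/hasP; exists m;
  rewrite ?mem_index_iota//= subrr.
Qed.

Lemma modulus_expB_le2 (R : realType) (z w : R[i]) n :
  modulus z <= 1 -> modulus w <= 1 -> modulus (z ^+ n - w ^+ n) <= 2.
Proof.
move=> z1 w1; apply: le_trans (modulusB _ _) _.
by rewrite -[2]/(1 + 1) lerD// modulusX_le1.
Qed.

Lemma prod_modulus_ge0 (R : realType) I (s : seq I) (P : pred I)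
    (F : I -> R[i]) : 0 <= \prod_(i <- s | P i) modulus (F i).
Proof. by apply: prodr_ge0 => i _; exact: modulus_ge0. Qed.

Lemma prod_block_modulus (R : realType) n (f : nat -> R[i]) z : block n f ->
  \prod_(0 <= m < 2 ^ n) modulus (z - f m) =
  modulus (z ^+ (2 ^ n) - f 0%N ^+ (2 ^ n)).
Proof. by move=> fn; rewrite -modulus_prod prod_block. Qed.

Lemma prod_block_le2 (R : realType) n (f : nat -> R[i]) z : block n f ->
  modulus z <= 1 -> \prod_(0 <= m < 2 ^ n) modulus (z - f m) <= 2.
Proof.
move=> fn z1; rewrite prod_block_modulus// modulus_expB_le2//.
by rewrite (block_unit fn)// expn_gt0.
Qed.

(** The half without [i] is a complete block product, at most 2; the other half is handled by
    induction. *)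
Lemma prod_blockD1_le (R : realType) n (f : nat -> R[i]) z i : block n f ->
  modulus z <= 1 -> (i < 2 ^ n)%N ->
  \prod_(0 <= m < 2 ^ n | m != i) modulus (z - f m) <= 2 ^+ n.
Proof.
move=> + z1; elim: n f i => [|n IH] f i.
  by rewrite expn0 ltnS leqn0 => _ /eqP->; rewrite big_mkcond big_nat1.
move=> /blockS[fn gn opp] i_lt.
rewrite (@big_cat_nat _ _ _ (2 ^ n))//=; last by rewrite leq_exp2l.
rewrite (big_nat_shift _ _ (2 ^ n)) expnS mul2n -addnn addnK exprS.
have [i_n|n_i] := ltnP i (2 ^ n).
  under [X in _ * X]eq_bigl do
    rewrite (_ : _ != i) ?gtn_eqF// ?ltn_addr// ?gtn_eqF//.
  rewrite mulrC ler_pM ?prod_modulus_ge0 ?(prod_block_le2 gn)// IH//.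
rewrite big_nat_neq_out; last by rewrite ltnNge n_i andbF.
under [X in _ * X]eq_bigl do rewrite -{1}(subnKC n_i) eqn_add2l.
rewrite ler_pM ?prod_modulus_ge0 ?prod_block_le2//.
by apply: (IH _ _ gn); rewrite ltn_subLR// addnn -mul2n -expnS.
Qed.

(** This is the modulus of the derivative of z^(2^n) - c at a root. In the induction, the half
    without [i] contributes exactly 2, since the 2^n-th powers of the halves are opposite. *)
Lemma prod_blockD1_root (R : realType) n (f : nat -> R[i]) i : block n f ->
  (i < 2 ^ n)%N ->
  \prod_(0 <= m < 2 ^ n | m != i) modulus (f i - f m) = 2 ^+ n.
Proof.
elim: n f i => [|n IH] f i.
  by rewrite expn0 ltnS leqn0 => _ /eqP->; rewrite big_mkcond big_nat1.
move=> /blockS[fn gn opp] i_lt.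
have f0 : modulus (f 0%N ^+ (2 ^ n)) = 1.
  by rewrite modulusX_unit// (block_unit fn)// expn_gt0.
rewrite (@big_cat_nat _ _ _ (2 ^ n))//=; last by rewrite leq_exp2l.
rewrite (big_nat_shift _ _ (2 ^ n)) expnS mul2n -addnn addnK exprS.
have [i_n|n_i] := ltnP i (2 ^ n).
  under [X in _ * X]eq_bigl do
    rewrite (_ : _ != i) ?gtn_eqF// ?ltn_addr// ?gtn_eqF//.
  by rewrite IH// (prod_block_modulus _ gn) addn0 opp opprK (block_exp fn)//
    two_modulus// mulrC.
rewrite big_nat_neq_out; last by rewrite ltnNge n_i andbF.
under [X in _ * X]eq_bigl do rewrite -{1}(subnKC n_i) eqn_add2l.
have i'_lt : (i - 2 ^ n < 2 ^ n)%N by rewrite ltn_subLR// addnn -mul2n -expnS.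
have /= := IH _ _ gn i'_lt; rewrite (subnKC n_i) => ->; congr (_ * _).
rewrite prod_block_modulus//; have /= := block_exp gn i'_lt.
by rewrite subnKC// addn0 opp => ->; rewrite -opprD modulusN two_modulus.
Qed.

(** The cut [j] falls in one half; the other half is a complete product in [z] alone or in [w]
    alone, at most 2. Each level thus costs a factor 2. *)
Lemma prod_block_split_le (R : realType) n (f : nat -> R[i]) z w j :
  block n f -> modulus z <= 1 -> modulus w <= 1 -> (j <= 2 ^ n)%N ->
  (\prod_(0 <= m < j) modulus (z - f m)) *
  (\prod_(j <= m < 2 ^ n) modulus (w - f m)) <= 2 ^+ n.+1.
Proof.
move=> + z1 w1; elim: n f j => [|n IH] f j.
  move=> f0; rewrite expn0 expr1; case: j => [|[|//]] _.
    by rewrite big_nil mul1r (prod_block_le2 f0).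
  by rewrite mulrC [X in X * _]big_geq// mul1r (prod_block_le2 f0).
move=> /blockS[fn gn opp] j_le.
have [j_n|n_j] := leqP j (2 ^ n).
  rewrite (@big_cat_nat _ _ _ (2 ^ n) j)//=; last by rewrite leq_exp2l.
  rewrite (big_nat_shift _ _ (2 ^ n) (2 ^ n.+1)) expnS mul2n -addnn addnK.
  rewrite mulrA mulrC exprS.
  by rewrite ler_pM ?mulr_ge0 ?prod_modulus_ge0 ?(prod_block_le2 gn)// IH.
rewrite (@big_cat_nat _ _ _ (2 ^ n) 0)//=; last exact: ltnW.
rewrite (big_nat_shift _ _ (2 ^ n) j) (big_nat_shiftl _ _ _ _ _ (ltnW n_j)).
have -> : (2 ^ n.+1 - 2 ^ n = 2 ^ n)%N by rewrite expnS mul2n -addnn addnK.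
rewrite -mulrA [leRHS]exprS.
rewrite ler_pM ?mulr_ge0 ?prod_modulus_ge0 ?prod_block_le2//.
by apply: (IH _ _ gn); rewrite leq_subLR addnn -mul2n -expnS.
Qed.

Lemma prod_block_splitD1_le (R : realType) n (f : nat -> R[i]) z w i j :
  block n f -> modulus z <= 1 -> modulus w <= 1 -> (i < j <= 2 ^ n)%N ->
  (\prod_(0 <= m < j | m != i) modulus (z - f m)) *
  (\prod_(j <= m < 2 ^ n) modulus (w - f m)) <= (2 ^+ n) ^+ 2.
Proof.
move=> + z1 w1; elim: n f i j => [|n IH] f i j.
  move=> f0; rewrite expn0 => ij.
  have [-> ->] : i = 0%N /\ j = 1%N by lia.
  by rewrite [X in _ * X]big_geq// big_mkcond big_nat1 mulr1 expr0 expr1n.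
move=> /blockS[fn gn opp] /andP[ij j_le].
have four : (2 ^+ n.+1) ^+ 2 = 2 * (2 * (2 ^+ n) ^+ 2) :> R.
  by rewrite (exprS _ n); ring.
have two (x y : R) : 0 <= x -> 0 <= y -> x <= 2 -> y <= (2 ^+ n) ^+ 2 ->
    x * y <= (2 ^+ n.+1) ^+ 2.
  move=> x0 y0 x2 yn; rewrite four.
  apply: le_trans (_ : 2 * (2 ^+ n) ^+ 2 <= _).
    by rewrite ler_pM.
  have : 0 <= (2 ^+ n) ^+ 2 :> R by rewrite sqr_ge0.
  by lra.
have [j_n|n_j] := leqP j (2 ^ n).
  rewrite (@big_cat_nat _ _ _ (2 ^ n) j)//=; last by rewrite leq_exp2l.
  rewrite (big_nat_shift _ _ (2 ^ n) (2 ^ n.+1)) expnS mul2n -addnn addnK.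
  rewrite mulrA mulrC.
  rewrite two ?mulr_ge0 ?prod_modulus_ge0 ?(prod_block_le2 gn)//.
  by rewrite IH// ij.
rewrite (@big_cat_nat _ _ _ (2 ^ n) 0)//=; last exact: ltnW.
rewrite (big_nat_shift _ _ (2 ^ n) j) (big_nat_shiftl _ _ _ _ _ (ltnW n_j)).
have -> : (2 ^ n.+1 - 2 ^ n = 2 ^ n)%N by rewrite expnS mul2n -addnn addnK.
have j'_le : (j - 2 ^ n <= 2 ^ n)%N by rewrite leq_subLR addnn -mul2n -expnS.
have [i_n|n_i] := ltnP i (2 ^ n).
  under [X in _ * X * _]eq_bigl do
    rewrite (_ : _ != i) ?gtn_eqF// ?ltn_addr// ?gtn_eqF//.
  rewrite -mulrA.
  have -> : (2 ^+ n.+1) ^+ 2 = 2 ^+ n * (2 * 2 ^+ n.+1) :> R.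
    by rewrite (exprS _ n); ring.
  rewrite ler_pM ?mulr_ge0 ?prod_modulus_ge0 ?prod_blockD1_le//.
  apply: le_trans (prod_block_split_le gn z1 w1 j'_le) _.
  by rewrite ler_peMl// ?exprn_ge0// ler1n.
rewrite big_nat_neq_out; last by rewrite ltnNge n_i andbF.
under [X in _ * X * _]eq_bigl do rewrite -{1}(subnKC n_i) eqn_add2l.
rewrite -mulrA two ?mulr_ge0 ?prod_modulus_ge0 ?prod_block_le2//.
by apply: (IH _ _ _ gn) => //; rewrite ltn_sub2r.
Qed.

(** * Real parts of a Leja sequence *)

Lemma bigD1_nat (R : realType) a b i (F : nat -> R) : (a <= i < b)%N ->
  \prod_(a <= m < b) F m = F i * \prod_(a <= m < b | m != i) F m.
Proof. by move=> iab; rewrite (bigD1_seq i)//= ?mem_index_iota// iota_uniq. Qed.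

(* The index at which the [i]-th distinct real part occurs for the first time:
   among [2 ^ n.+1 <= m < 2 ^ n.+2], the first [2 ^ n] terms have new real parts
   and the others are their conjugates. *)
Definition first_index (i : nat) : nat :=
  if i is i'.+1 then (2 ^ trunc_log 2 i' + i')%N else 0%N.

(** The offset [(2 ^ n).+1] is the number of distinct real parts of the 2^(n+1)-th roots of unity:
    conjugate pairs coincide, while 1 and -1 stand alone. *)
Lemma first_index_block n r : (r < 2 ^ n)%N ->
  first_index ((2 ^ n).+1 + r) = (2 ^ n.+1 + r)%N.
Proof.
move=> rn; rewrite addSn /= (@trunc_log_eq 2 n)//; first by rewrite expnS; lia.
by rewrite leq_addr expnS mul2n -addnn ltn_add2l.
Qed.

Lemma first_index_lt n i : (i < (2 ^ n).+1)%N -> (first_index i < 2 ^ n.+1)%N.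
Proof.
have n0 : (0 < 2 ^ n)%N by rewrite expn_gt0.
case: i => [|[|i]] /=; rewrite expnS; first by lia.
  (* By the default value [trunc_log 2 0 = 0], [first_index 1] is 1, as it should be. *)
  by rewrite trunc_log0; lia.
by have := trunc_logP (isT : 1 < 2)%N (isT : 0 < i.+1)%N; lia.
Qed.

(** * Products of distances to the nodes and their conjugates *)

Section Nodes.
Variables (R : realType) (e : nat -> R[i]).
Hypotheses (e_block : forall n, block n e) (e0 : e 0%N = 1).

Definition node l := e (first_index l).
(** For [m < 2 ^ n], these are the points g_m, with N = 2^n; the remaining half of the new terms of
    [e] is left out. *)
Definition tail n m := e (2 ^ n.+1 + m)%N.
(** On the unit circle this is twice the distance of the real parts ([cdist_Re]); the factored form
    lets the block estimates apply to [z] and to its conjugate separately. *)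
Definition cdist (z b : R[i]) := modulus (z - b) * modulus (z^* - b).

Lemma node_tail n m : (m < 2 ^ n)%N -> node ((2 ^ n).+1 + m) = tail n m.
Proof. by move=> mn; rewrite /node first_index_block. Qed.

Lemma e_unit m : modulus (e m) = 1.
Proof. by apply: (block_unit (e_block m)); exact: ltn_expl. Qed.

Lemma node_unit l : modulus (node l) = 1. Proof. exact: e_unit. Qed.

Lemma e_exp n m : (m < 2 ^ n)%N -> e m ^+ (2 ^ n) = 1.
Proof. by move=> mn; rewrite (block_exp (e_block n))// e0 expr1n. Qed.

Lemma node_exp n l : (l < (2 ^ n).+1)%N -> node l ^+ (2 ^ n.+1) = 1.
Proof. by move=> ln; apply: e_exp; exact: first_index_lt. Qed.

Lemma tail_block n : block n (tail n).
Proof. by have /blockS[_ /blockS[]] := e_block n.+2. Qed.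

Lemma tail_exp n m : (m < 2 ^ n)%N -> tail n m ^+ (2 ^ n) = tail n 0 ^+ (2 ^ n).
Proof. by move=> mn; rewrite (block_exp (tail_block n)). Qed.

Lemma tail_exp_sqr n : (tail n 0 ^+ (2 ^ n)) ^+ 2 = -1.
Proof.
have /blockS[_ _] := e_block n.+2.
by rewrite -expr_double /tail addn0 e0 expr1n.
Qed.

(** A square root of -1 is purely imaginary. *)
Lemma tail_expJ n : (tail n 0 ^+ (2 ^ n))^* = - tail n 0 ^+ (2 ^ n).
Proof.
have := mulJ_unit (modulusX_unit (2 ^ n) (e_unit (2 ^ n.+1 + 0))).
have := tail_exp_sqr n; rewrite -/(tail n 0);
  set c := tail n 0 ^+ (2 ^ n) => c2 cc.
by rewrite -[LHS]mul1r -[1]opprK -c2 expr2 mulNr -mulrA cc mulr1.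
Qed.

Lemma cdist_ge0 z b : 0 <= cdist z b.
Proof. by rewrite mulr_ge0 ?modulus_ge0. Qed.

Lemma prod_cdist (s : seq nat) (P : pred nat) (f : nat -> R[i]) z :
  \prod_(m <- s | P m) cdist z (f m) =
  (\prod_(m <- s | P m) modulus (z - f m)) *
  (\prod_(m <- s | P m) modulus (z^* - f m)).
Proof. by rewrite -big_split. Qed.

Lemma modulus_sqrB1 (z : R[i]) :
  modulus z = 1 -> modulus (z ^+ 2 - 1) = modulus (z^* - z).
Proof.
move=> z1; rewrite -(mulJ_unit z1) expr2 -mulrBr modulusM z1 mul1r.
exact: modulusBC.
Qed.

(** With N = 2^n and c the common N-th power of the block, the two factors are |z^N - c| and, after
    conjugation, |z^N + c|; moreover c^2 = -1. *)
Lemma prod_tail_cdist n z :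
  \prod_(0 <= m < 2 ^ n) cdist z (tail n m) = modulus (z ^+ (2 ^ n.+1) + 1).
Proof.
rewrite prod_cdist !(prod_block_modulus _ (tail_block n)).
rewrite -[X in _ * X]modulusJ rmorphB /= tail_expJ opprK rmorphXn /= conjcK.
rewrite -modulusM expr_double; congr modulus.
by rewrite -[1]opprK -(tail_exp_sqr n) subr_sqr.
Qed.

Lemma prod_node_tail n j i z : (j <= 2 ^ n)%N ->
  \prod_(0 <= l < (2 ^ n).+1 + j | l != i) cdist z (node l) =
  \prod_(0 <= l < (2 ^ n).+1 | l != i) cdist z (node l) *
  \prod_(0 <= m < j | (2 ^ n).+1 + m != i) cdist z (tail n m).
Proof.
move=> jn; rewrite (@big_cat_nat _ _ _ (2 ^ n).+1)//= ?leq_addr//.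
rewrite (big_nat_shift _ _ (2 ^ n).+1) addKn; congr (_ * _).
rewrite big_nat_cond [RHS]big_nat_cond.
apply: eq_bigr => m /andP[/andP[_ mj] _].
by rewrite node_tail// (leq_trans mj).
Qed.

(** The nodes and their conjugates run through all 2^(n+1)-th roots of unity, with 1 and -1 counted
    twice; hence the extra factor z^2 - 1. *)
Lemma prod_node_cdist n z : modulus z = 1 ->
  \prod_(0 <= l < (2 ^ n).+1) cdist z (node l) =
  modulus (z ^+ 2 - 1) * modulus (z ^+ (2 ^ n.+1) - 1).
Proof.
move=> z1; elim: n => [|n IH].
  have /blockS[_ _] := e_block 1; rewrite !expr1 e0 => e1.
  rewrite big_nat_recr//= big_nat1 /cdist /node /= e0 e1 opprK.
  have J (b : R[i]) : b^* = b -> modulus (z^* - b) = modulus (z - b).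
    by move=> bb; rewrite -modulusJ rmorphB /= conjcK bb.
  have J' : modulus (z^* + 1) = modulus (z + 1).
    by rewrite -modulusJ rmorphD rmorph1 /= conjcK.
  rewrite J ?conjc1// J' mulrACA -!modulusM.
  by rewrite expn1 subr_sqr_1.
rewrite expnS mul2n -addnn -addSn.
rewrite (@big_cat_nat _ _ _ (2 ^ n).+1)//= ?leq_addr//.
rewrite (big_nat_shift _ _ (2 ^ n).+1) addKn IH.
under eq_big_nat => m /andP[_ mn] do rewrite node_tail//.
rewrite prod_tail_cdist -mulrA -modulusM; congr (_ * modulus _).
by rewrite [in RHS]expr_double subr_sqr_1.
Qed.

Lemma prod_node_step n i z : (i < (2 ^ n.+1).+1)%N ->
  \prod_(0 <= l < (2 ^ n.+1).+1 | l != i) cdist z (node l) =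
  \prod_(0 <= l < (2 ^ n).+1 | l != i) cdist z (node l) *
  \prod_(0 <= m < 2 ^ n | (2 ^ n).+1 + m != i) cdist z (tail n m).
Proof. by move=> i_lt; rewrite -prod_node_tail// addSn addnn -mul2n -expnS. Qed.

(** Induction on [n]: for an old node the new nodes contribute a factor 2, and for a new node the
    product is computed exactly. *)
Lemma prod_node_ge n i : (i < (2 ^ n).+1)%N ->
  2 ^+ n.+1 <= \prod_(0 <= l < (2 ^ n).+1 | l != i) cdist (node i) (node l).
Proof.
elim: n i => [|n IH] i i_lt.
  have /blockS[_ _] := e_block 1; rewrite !expr1 e0 => e1.
  have [n0 n1] : node 0 = 1 /\ node 1 = -1 by split.
  rewrite big_mkcond big_nat_recr//= big_nat1.
  have : i = 0%N \/ i = 1%N by lia.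
  case=> -> /=; rewrite /cdist n0 n1 ?rmorphN rmorph1 ?opprK ?mul1r ?mulr1.
    by rewrite two_modulus ?(modulus_nat R 1)//; lra.
  by rewrite -opprD modulusN two_modulus ?(modulus_nat R 1)//; lra.
rewrite prod_node_step//.
have [i_n|n_i] := ltnP i (2 ^ n).+1.
  under [X in _ * X]eq_bigl do
    rewrite (_ : _ != i) ?gtn_eqF// ?(leq_trans i_n)// ?leq_addr//.
  rewrite prod_tail_cdist node_exp// two_modulus ?(modulus_nat R 1)//.
  by rewrite mulrC exprS ler_pM2l// IH.
have iE := subnKC n_i; set m0 := (i - _)%N in iE.
have m0_lt : (m0 < 2 ^ n)%N by rewrite /m0; move: i_lt; rewrite expnS; lia.
rewrite big_nat_neq_out; last by rewrite ltnNge n_i.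
under [X in _ * X]eq_bigl do rewrite -{1}iE eqn_add2l.
have bE : node i = tail n m0 by rewrite -iE node_tail.
set b := node i in bE *.
have b1 : modulus b = 1 by apply: node_unit.
have bN : b ^+ (2 ^ n) = tail n 0 ^+ (2 ^ n) by rewrite bE tail_exp.
rewrite prod_node_cdist// prod_cdist {3}bE (prod_blockD1_root (tail_block n))//.
rewrite expr_double bN tail_exp_sqr -opprD modulusN.
rewrite two_modulus ?(modulus_nat R 1)// modulus_sqrB1//.
(* The factor coming from b^2 - 1 is the one missing from the product at the conjugate of b;
   together they form a complete block product, equal to 2. *)
have : modulus (b^* - b) *
    \prod_(0 <= m < 2 ^ n | m != m0) modulus (b^* - tail n m) = 2.
  rewrite {2}bE -(bigD1_nat (fun m => modulus (b^* - tail n m)) (i := m0))//.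
  rewrite (prod_block_modulus _ (tail_block n)) -rmorphXn /= bN tail_expJ.
  by rewrite -opprD modulusN two_modulus// modulusX_unit// e_unit.
set p := \prod_(_ <= _ < _ | _) _; set a := modulus _ => ap.
have -> : a * 2 * (2 ^+ n * p) = 2 * 2 ^+ n * (a * p) by ring.
by rewrite ap !exprS; lra.
Qed.

Lemma modulus_expB1_le (z w : R[i]) n : modulus z = 1 -> modulus w = 1 ->
  modulus (z ^+ n - w ^+ n) <= n%:R * modulus (z - w).
Proof.
move=> z1 w1; elim: n => [|n IH].
  by rewrite !expr0 subrr mul0r -[0]/(0%:R) modulus_nat.
have -> : z ^+ n.+1 - w ^+ n.+1 = z * (z ^+ n - w ^+ n) + (z - w) * w ^+ n.
  by rewrite !exprS; ring.
apply: le_trans (modulusD _ _) _.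
rewrite !modulusM z1 mul1r modulusX_unit// mulr1 -natr1 mulrDl mul1r.
by rewrite lerD2r.
Qed.

(* The nearer of [z], [z^*] to [b] is taken as [z], so that the other factor of
   [cdist z b] absorbs [z ^+ 2 - 1]. *)
Lemma modulus_sqrB1_le (z b : R[i]) : modulus z = 1 ->
  modulus (z - b) <= modulus (z^* - b) ->
  modulus (z ^+ 2 - 1) <= 2 * modulus (z^* - b).
Proof.
move=> z1 zb; rewrite modulus_sqrB1//.
have -> : z^* - z = (z^* - b) - (z - b) by ring.
by have := modulusB (z^* - b) (z - b); lra.
Qed.

(** The full product is |z^2 - 1| |z^(2N) - b^(2N)| with N = 2^n and b = [node i]. To divide out
    [cdist z b], the first factor is compared with the distance from the conjugate of z to b, the
    second with |z - b|. *)
Lemma prod_node_le n i z : (i < (2 ^ n).+1)%N -> modulus z = 1 ->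
  z != node i -> modulus (z - node i) <= modulus (z^* - node i) ->
  \prod_(0 <= l < (2 ^ n).+1 | l != i) cdist z (node l) <= 2 ^+ n.+2.
Proof.
move=> i_lt z1 zi le_zi.
have zi0 : 0 < modulus (z - node i).
  by rewrite lt_neqAle modulus_ge0 eq_sym modulus_eq0 subr_eq0 zi.
have d0 : 0 < cdist z (node i) by rewrite mulr_gt0// (lt_le_trans zi0).
rewrite -(ler_pM2l d0) -(bigD1_nat (fun l => cdist z (node l)))//.
rewrite prod_node_cdist// -[X in _ * modulus (_ - X)](node_exp i_lt).
have -> : cdist z (node i) * 2 ^+ n.+2 =
    2 * modulus (z^* - node i) * ((2 ^ n.+1)%:R * modulus (z - node i)).
  by rewrite /cdist natrX (exprS _ n.+1); ring.
by rewrite ler_pM ?modulus_ge0 ?modulus_sqrB1_le ?modulus_expB1_le ?node_unit.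
Qed.

(** This is the bound on a Lagrange polynomial, carried over to the circle and cleared of
    denominators. *)
Lemma prod_node_ratio n j i z : (j <= 2 ^ n)%N -> (i < (2 ^ n).+1 + j)%N ->
  modulus z = 1 -> z != node i ->
  modulus (z - node i) <= modulus (z^* - node i) ->
  \prod_(0 <= l < (2 ^ n).+1 + j | l != i) cdist z (node l) <=
  (2 ^+ n.+1) ^+ 2 *
  \prod_(0 <= l < (2 ^ n).+1 + j | l != i) cdist (node i) (node l).
Proof.
move=> jn i_lt z1 zi le_zi.
have z1' : modulus z^* = 1 by rewrite modulusJ.
set b := node i; have b1 : modulus b = 1 by apply: node_unit.
have b1' : modulus b^* = 1 by rewrite modulusJ.
set T := \prod_(_ <= _ < _ | _) cdist b _.
(* The two values of [Vc], at b and at its conjugate, supply the nodes that complete the denominator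
   to the next level, where [prod_node_ge] applies. Both sides are then multiplied by them. *)
pose Vc w := \prod_(j <= m < 2 ^ n) modulus (w - tail n m).
have Vc0 w : 0 <= Vc w by exact: prod_modulus_ge0.
have T0 : 0 <= T by apply: prodr_ge0 => l _; exact: cdist_ge0.
have lower : 2 ^+ n.+2 <= T * (Vc b * Vc b^*).
  have i_lt' : (i < (2 ^ n.+1).+1)%N by rewrite expnS; lia.
  apply: le_trans (prod_node_ge i_lt') _.
  rewrite (@big_cat_nat _ _ _ ((2 ^ n).+1 + j))//=; last by rewrite expnS; lia.
  rewrite -/b -/T (big_nat_neq_out _ _ (a := (2 ^ n).+1 + j)%N); last by lia.
  rewrite (big_nat_shiftl _ _ _ _ _ (leq_addr j (2 ^ n).+1)) addKn.
  have -> : ((2 ^ n.+1).+1 - (2 ^ n).+1 = 2 ^ n)%N by rewrite expnS; lia.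
  under eq_big_nat => m /andP[_ mn] do rewrite node_tail//.
  by rewrite prod_cdist.
have VV0 : 0 < Vc b * Vc b^*.
  rewrite lt_neqAle mulr_ge0// andbT; apply/eqP => VV.
  have := lt_le_trans (exprn_gt0 n.+2 (ltr0Sn R 1)) lower.
  by rewrite -VV mulr0 ltxx.
rewrite -(ler_pM2r VV0) -mulrA.
apply: le_trans (_ : (2 ^+ n.+1) ^+ 2 * 2 ^+ n.+2 <= _); last first.
  by rewrite ler_pM2l// ?exprn_gt0.
rewrite prod_node_tail//.
(* For a node of the complete level, [prod_node_le] bounds the first product by 2^(n+2), and the
   tail products at z and at its conjugate, each paired with one [Vc], are at most 2^(n+1). *)
have [i_n|n_i] := ltnP i (2 ^ n).+1.
  under [X in _ * X * _]eq_bigl do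
    rewrite (_ : _ != i) ?gtn_eqF// ?(leq_trans i_n)// ?leq_addr//.
  rewrite [X in _ * X * _]prod_cdist -mulrA [leRHS]mulrC.
  rewrite ler_pM ?mulr_ge0 ?prod_modulus_ge0 ?prod_node_le//.
    by apply: prodr_ge0 => l _; exact: cdist_ge0.
  rewrite mulrACA expr2 ler_pM ?mulr_ge0 ?prod_modulus_ge0// /Vc.
    by rewrite (prod_block_split_le (tail_block n)) ?z1 ?b1.
  by rewrite (prod_block_split_le (tail_block n)) ?z1' ?b1'.
have iE := subnKC n_i; set m0 := (i - _)%N in iE.
have m0_lt : (m0 < j)%N by rewrite /m0; move: i_lt; lia.
rewrite big_nat_neq_out; last by rewrite ltnNge n_i.
under [X in _ * X * _]eq_bigl do rewrite -{1}iE eqn_add2l.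
have bE : b = tail n m0 by rewrite /b -iE node_tail// (leq_trans m0_lt).
rewrite prod_node_cdist// prod_cdist.
set p := \prod_(0 <= m < j | m != m0) modulus (z - _).
set q := \prod_(0 <= m < j | m != m0) modulus (z^* - _).
(* For a node of the tail both products lack the index [m0]. The bound on |z^2 - 1| restores the
   missing factor at the conjugate of z, so only the product at z keeps the gap. *)
have V1 : p * Vc b <= (2 ^+ n) ^+ 2.
  by rewrite (prod_block_splitD1_le (tail_block n)) ?z1 ?b1 ?m0_lt.
have V2 : modulus (z^* - b) * q * Vc b^* <= 2 ^+ n.+1.
  rewrite {1}bE -(bigD1_nat (fun m => modulus (z^* - tail n m)))//.
  by rewrite (prod_block_split_le (tail_block n)) ?z1' ?b1'.
have zz := modulus_sqrB1_le z1 le_zi.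
have z2 : modulus (z ^+ (2 ^ n.+1) - 1) <= 2.
  by rewrite -(expr1n _ (2 ^ n.+1)) modulus_expB_le2 ?z1 ?(modulus_nat R 1).
set x := modulus (z ^+ 2 - 1) in zz *; set y := modulus (z ^+ _ - 1) in z2 *.
set d := modulus (z^* - b) in zz V2.
have p0 : 0 <= p by exact: prod_modulus_ge0.
have q0 : 0 <= q by exact: prod_modulus_ge0.
have y0 : 0 <= y by exact: modulus_ge0.
have x0 : 0 <= x by exact: modulus_ge0.
have -> : x * y * (p * q) * (Vc b * Vc b^*) =
  x * y * ((p * Vc b) * (q * Vc b^*)) by ring.
apply: le_trans (_ : 2 * d * 2 * ((p * Vc b) * (q * Vc b^*)) <= _).
  by rewrite ler_wpM2r ?mulr_ge0// ler_pM.
have -> : 2 * d * 2 * (p * Vc b * (q * Vc b^*)) =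
  4 * ((p * Vc b) * (d * q * Vc b^*)) by ring.
apply: le_trans (_ : 4 * ((2 ^+ n) ^+ 2 * 2 ^+ n.+1) <= _).
  by rewrite ler_pM2l// ler_pM// ?mulr_ge0// ?modulus_ge0.
have n0 : 0 <= 2 ^+ n :> R by rewrite exprn_ge0.
have n03 : 0 <= (2 ^+ n) ^+ 3 :> R by rewrite exprn_ge0.
rewrite !(exprS 2 n.+1) !(exprS 2 n).
have -> : 4 * ((2 ^+ n) ^+ 2 * (2 * 2 ^+ n)) = 8 * (2 ^+ n) ^+ 3 :> R by ring.
have -> : (2 * 2 ^+ n) ^+ 2 * (2 * (2 * 2 ^+ n)) = 16 * (2 ^+ n) ^+ 3 :> R.
  by ring.
by lra.
Qed.

End Nodes.

(** * First occurrences of the real parts, and Lagrange polynomials *)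

Lemma pow2_block k : (0 < k)%N ->
  exists n r, (r < 2 ^ n)%N /\ k = (2 ^ n + r)%N.
Proof.
move=> k0; have /= /andP[lo hi] := trunc_log_bounds (isT : 1 < 2)%N k0.
exists (trunc_log 2 k), (k - 2 ^ trunc_log 2 k)%N; rewrite subnKC//; split=> //.
by move: hi; rewrite expnS; lia.
Qed.

Lemma first_index_homo : {homo first_index : i j / (i < j)%N}.
Proof.
case=> [|i] [|j]//=; first by rewrite addn_gt0 expn_gt0.
rewrite ltnS => ij.
by rewrite -addnS leq_add// leq_exp2l// leq_trunc_log// ltnW.
Qed.

(** An increasing enumeration is determined by its range; this identifies the index map hidden in
    [dedup_of] with [first_index]. *)
Lemma homo_range_uniq (f g : nat -> nat) :
  {homo f : i j / (i < j)%N} -> {homo g : i j / (i < j)%N} ->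
  range f = range g -> f = g.
Proof.
have le (u v : nat -> nat) i : {homo u : i j / (i < j)%N} ->
    {homo v : i j / (i < j)%N} -> range u = range v ->
    (forall j, (j < i)%N -> u j = v j) -> (u i <= v i)%N.
  move=> um vm uv uvi; have : range u (v i) by rewrite uv; exists i.
  case=> j _ ujvi; rewrite -ujvi; case: (ltngtP i j) => [/um/ltnW//|ji|->//].
  by have := vm _ _ ji; rewrite -(uvi _ ji) ujvi ltnn.
move=> fm gm fg; apply/funext; elim/ltn_ind => i IH.
by apply/eqP; rewrite eqn_leq !le// => j ji; rewrite IH.
Qed.

Section RealParts.
Variables (R : realType) (e : nat -> R[i]).
Hypotheses (e_block : forall n, block n e) (e0 : e 0%N = 1).

Lemma cdist_Re (z b : R[i]) : modulus z = 1 -> modulus b = 1 ->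
  cdist z b = 2 * `|complex.Re z - complex.Re b|.
Proof.
move=> z1 b1.
have ReJ (u : R[i]) : u + u^* = 2 * (complex.Re u)%:C.
  rewrite -[2](rmorph_nat (real_complex R)) -rmorphM.
  by case: u => x y; congr Complex => /=; rewrite ?mulr_natl ?subrr.
(* Both constants 1 = |z|^2 = |b|^2 are used: the second one lets [b] factor out. *)
have E : (z - b) * (z^* - b) = 2 * b * (complex.Re b - complex.Re z)%:C.
  have -> : (z - b) * (z^* - b) = z * z^* - b * (z + z^*) + b ^+ 2 by ring.
  rewrite mulJ_unit// -[X in X - _](mulJ_unit b1) ReJ rmorphB /=.
  by have := ReJ b; rewrite addrC => /(canRL (addrK _)) ->; ring.
rewrite /cdist -modulusM E !modulusM b1 mulr1 modulus_nat; congr (_ * _).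
rewrite distrC; apply: complexI.
by rewrite modulusE normc_def /= expr0n addr0 sqrtr_sqr.
Qed.

Lemma Re_eq_unit (z b : R[i]) : modulus z = 1 -> modulus b = 1 ->
  complex.Re z = complex.Re b -> z = b \/ z^* = b.
Proof.
move=> z1 b1 zb; have /eqP := cdist_Re z1 b1.
rewrite zb subrr normr0 mulr0 mulf_eq0 !modulus_eq0 !subr_eq0.
by case/orP => /eqP; [left|right].
Qed.

Lemma Re_conj (z : R[i]) : complex.Re z^* = complex.Re z.
Proof. by case: z. Qed.

Lemma opp_neq_unit (c : R[i]) : modulus c = 1 -> - c <> c.
Proof.
move=> c1 cc; have := two_modulus c1; rewrite -{1}cc addNr.
by rewrite (modulus_nat R 0); lra.
Qed.

(** The second half of the new terms has 2^n-th power -c, the conjugate of c, so the conjugates of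
    its terms are roots of z^(2^n) = c, all of which lie in [tail]. Hence their real parts are
    repetitions. *)
Lemma tail_conj_mem n m : (m < 2 ^ n)%N ->
  exists2 l, (l < 2 ^ n)%N & tail e n l = (e (2 ^ n.+1 + (2 ^ n + m)))^*.
Proof.
move=> mn; set w := e _.
have /blockS[_ /blockS[tb hb opp] _] := e_block n.+2.
have wN : w ^+ (2 ^ n) = - tail e n 0 ^+ (2 ^ n).
  by rewrite (block_exp hb mn) addn0 opp.
have := prod_block w^* (tail_block e_block n).
rewrite -rmorphXn /= wN rmorphN /= tail_expJ// opprK subrr => /eqP.
rewrite prodf_seq_eq0 => /hasP[l]; rewrite mem_index_iota => /andP[_ ln] /=.
by rewrite subr_eq0 => /eqP ->; exists l.
Qed.

Lemma Re_tail_new n r j : (r < 2 ^ n)%N -> (j < 2 ^ n.+1 + r)%N ->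
  complex.Re (e j) <> complex.Re (tail e n r).
Proof.
move=> rn j_lt Re_eq.
have c1 : modulus (tail e n 0 ^+ (2 ^ n)) = 1.
  by apply: modulusX_unit; exact: (e_unit e_block).
have alt : e j = tail e n r \/ (e j)^* = tail e n r.
  by apply: Re_eq_unit => //; exact: (e_unit e_block).
(* Earlier terms outside the tail are 2^(n+1)-th roots of unity, whereas tail points have that power
   equal to -1. *)
have [j_n|n_j] := ltnP j (2 ^ n.+1).
  have : tail e n r ^+ (2 ^ n.+1) = 1.
    case: alt => <-.
      by rewrite e_exp.
    by rewrite -rmorphXn /= e_exp// rmorph1.
  rewrite expr_double tail_exp// tail_exp_sqr//.
  by apply: opp_neq_unit; exact: (modulus_nat R 1).
have jE := subnKC n_j; set m := (j - _)%N in jE.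
have m_lt : (m < r)%N by rewrite -jE ltn_add2l in j_lt.
have mn : (m < 2 ^ n)%N by apply: ltn_trans rn.
have ejE : e j = tail e n m by rewrite -jE.
(* Two equal points would annul the product of [prod_blockD1_root]; two conjugate ones would give c
   = -c on taking 2^n-th powers. *)
case: alt => ejr.
  have := prod_blockD1_root (tail_block e_block n) rn.
  have -> : \prod_(0 <= l < 2 ^ n | l != r)
      modulus (tail e n r - tail e n l) = 0.
    apply/eqP; rewrite prodf_seq_eq0; apply/hasP; exists m.
      by rewrite mem_index_iota.
    by rewrite ltn_eqF//= -ejE ejr subrr (modulus_nat R 0).
  by move=> /esym/eqP; rewrite expf_eq0 pnatr_eq0 andbF.
have := congr1 (fun u => u ^+ (2 ^ n)) ejr.
rewrite -rmorphXn /= ejE !tail_exp// tail_expJ//.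
exact: opp_neq_unit.
Qed.

Lemma range_first_index : range first_index =
  [set k | forall j, (j < k)%N -> complex.Re (e j) <> complex.Re (e k)].
Proof.
have e1 : e 1%N = -1.
  by have /blockS[_ _] := e_block 1; rewrite !expr1 e0.
apply/seteqP; split=> [_ [[|[|i]] _ <-]|k /= new].
- by move=> j; rewrite ltn0.
- rewrite /first_index trunc_log0 addn0 expn0 => -[|j]//= _.
  by rewrite e0 e1 /=; lra.
- have [n [r [rn iE]]] := pow2_block (ltn0Sn i).
  rewrite iE -addSn first_index_block//= => j j_lt.
  exact: Re_tail_new.
case: k new => [|[|k]] new; [by exists 0%N|by exists 1%N|].
have [n [r [rn kE]]] := pow2_block (ltn0Sn k.+1).
case: n kE rn => [|n] kE rn; first by move: rn kE; rewrite expn0; lia.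
rewrite kE in new *.
have [r_n|n_r] := ltnP r (2 ^ n).
  by exists ((2 ^ n).+1 + r)%N => //; rewrite first_index_block.
have r'n : (r - 2 ^ n < 2 ^ n)%N by move: rn; rewrite expnS; lia.
have [l ln lE] := tail_conj_mem r'n.
have := new (2 ^ n.+1 + l)%N; case; first by rewrite ltn_add2l (leq_trans ln).
by rewrite -[LHS]/(complex.Re (tail e n l)) lE Re_conj subnKC.
Qed.

Lemma Re_node_inj : injective (fun i => complex.Re (node e i)).
Proof.
have lt_neq i j : (i < j)%N -> complex.Re (node e i) <> complex.Re (node e j).
  move=> ij; have : range first_index (first_index j) by exists j.
  rewrite range_first_index => /(_ (first_index i)); apply.
  exact: first_index_homo.
move=> i j eq_ij; case: (ltngtP i j) => // ij; first by case: (lt_neq _ _ ij).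
by case: (lt_neq _ _ ij).
Qed.

Lemma prod_node_ratio_Re n j i X : (j <= 2 ^ n)%N -> (i < (2 ^ n).+1 + j)%N ->
  X \in `[-1, 1]%R ->
  \prod_(0 <= l < (2 ^ n).+1 + j | l != i)
    (`|X - complex.Re (node e l)| /
     `|complex.Re (node e i) - complex.Re (node e l)|) <= (2 ^+ n.+1) ^+ 2.
Proof.
move=> jn i_lt XI.
(* Both points of the circle above and below [X] have real part [X]; the one nearer to the node is
   taken. *)
have [z z1 [zX le_zi]] : exists2 z : R[i], modulus z = 1 &
    complex.Re z = X /\ modulus (z - node e i) <= modulus (z^* - node e i).
  pose z := X +i* Num.sqrt (1 - X ^+ 2).
  have z1 : modulus z = 1.
    apply: complexI; rewrite modulusE normc_def /= sqr_sqrtr.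
      by rewrite addrC subrK sqrtr1.
    by move: XI; rewrite in_itv /=; nra.
  have [le_zi|/ltW le_zi] :=
      lerP (modulus (z - node e i)) (modulus (z^* - node e i)).
    by exists z.
  by exists z^*; rewrite ?modulusJ ?conjcK.
have ratioE l : `|X - complex.Re (node e l)| /
    `|complex.Re (node e i) - complex.Re (node e l)| =
    cdist z (node e l) / cdist (node e i) (node e l).
  rewrite !cdist_Re ?(node_unit e_block)// zX invfM mulrACA divff ?mul1r//.
under eq_bigr do rewrite ratioE.
rewrite prodf_div ler_pdivrMr; last first.
  apply: prodr_gt0 => l li; rewrite cdist_Re ?(node_unit e_block)//.
  rewrite mulr_gt0// normr_gt0 subr_eq0.
  by apply: contra li => /eqP/Re_node_inj ->.
(* At the node itself both products agree and the constant is at least 1. *)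
have [->|zi] := eqVneq z (node e i); last exact: prod_node_ratio.
rewrite ler_peMl ?exprn_ege1 ?ler1n//.
by apply: prodr_ge0 => l _; exact: cdist_ge0.
Qed.

End RealParts.

(** * The bound on the Lebesgue constant *)

Lemma ReLeja_node (R : realType) (x : nat -> R) : ReLeja x ->
  exists e : nat -> R[i], [/\ forall n, block n e, e 0%N = 1 &
    forall i, x i = complex.Re (node e i)].
Proof.
case=> e eL [n [nm nr xE]]; have e_block m := Leja_block m eL.
have e0 : e 0%N = 1 by case: eL.
exists e; split=> // i; rewrite xE.
rewrite (homo_range_uniq nm first_index_homo)// nr.
by rewrite (range_first_index e_block e0).
Qed.

Lemma big_first_points (R : realType) (x : nat -> R) k (T : Type) (idx : T)
    (op : Monoid.com_law idx) (P : pred R) (F : R -> T) : injective x ->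
  \big[op/idx]_(b <- first_points x k | P b) F b =
  \big[op/idx]_(0 <= l < k | P (x l)) F (x l).
Proof.
move=> x_inj; rewrite -(big_map x P F); apply: perm_big; apply: uniq_perm.
- exact: fset_uniq.
- by rewrite map_inj_uniq// iota_uniq.
move=> b; apply/imfsetP/mapP => /= [[i _ ->]|[l]].
  by exists (val i) => //; rewrite mem_index_iota /= ltn_ord.
by rewrite mem_index_iota => /= lk ->; exists (Ordinal lk).
Qed.

Lemma lebesgue_constant_le (R : realType) (x : nat -> R) k : ReLeja x ->
  (1 < k)%N -> 0 <= lebesgue_constant (first_points x k) <= 4 * k%:R ^+ 3.
Proof.
move=> /ReLeja_node [e [e_block e0 xE]] k1.
have x_inj : injective x.
  by move=> i j; rewrite !xE => /(Re_node_inj e_block e0).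
have [X XI [<- _]] := lebesgue_constant_max (first_points x k).
apply/andP; split; first by apply: sumr_ge0.
have [n [j [jn kE]]] : exists n j, (j < 2 ^ n)%N /\ k = ((2 ^ n).+1 + j)%N.
  have [|n [j [jn kE]]] := @pow2_block k.-1; first by lia.
  by exists n, j; split=> //; lia.
rewrite /lebesgue_fun big_first_points//.
have term i : (0 <= i < k)%N ->
    `|lagrange_fun (first_points x k) (x i) X| <= 4 * k%:R ^+ 2.
  move=> /= ik; rewrite /lagrange_fun big_first_points// normr_prod.
  apply: le_trans (_ : (2 ^+ n.+1) ^+ 2 <= _).
    have := @prod_node_ratio_Re _ e e_block e0 n j i X (ltnW jn).
    rewrite -kE ik => /(_ isT XI); apply: le_trans.
    rewrite le_eqVlt; apply/orP; left; apply/eqP; apply: eq_big => [l|l _].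
      by rewrite (inj_eq x_inj).
    by rewrite normrM normfV !xE.
  (* Since 2^n < k, each of the k terms is at most 4 k^2. *)
  have -> : (2 ^+ n.+1) ^+ 2 = 4 * (2 ^ n)%:R ^+ 2 :> R.
    by rewrite natrX (exprS 2 n); ring.
  by rewrite ler_pM2l// ler_pXn2r ?nnegrE// ler_nat; lia.
apply: le_trans (_ : \sum_(0 <= i < k) 4 * k%:R ^+ 2 <= _).
  by rewrite ler_sum_nat.
by rewrite sumr_const_nat subn0 -[leLHS]mulr_natr -mulrA -exprSr.
Qed.

Theorem theorem3p1 (R : realType) (x : nat -> R) (hx : ReLeja x) :
  (fun k : nat => lebesgue_constant (first_points x k) : R^o) =O_\oo
  (fun k : nat => k%:R ^+ 3 * ln k%:R : R^o).
Proof.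
have ln2 : 0 < ln (2 : R) by rewrite ln_gt0 ?ltr1n.
(* The logarithm only weakens the cubic bound: ln k / ln 2 >= 1 for k >= 2. *)
apply/eqO_exP; exists (4 / ln 2); first by rewrite divr_gt0.
near=> k.
have k2 : (1 < k)%N by near: k; exists 2%N.
have /andP[leb0 leb] := lebesgue_constant_le hx k2.
have lnk : ln 2 <= ln k%:R :> R by rewrite ler_ln ?posrE ?ltr0n ?ler_nat// ltnW.
have lnk0 : 0 <= ln k%:R :> R by rewrite (le_trans (ltW ln2)).
rewrite !ger0_norm ?mulr_ge0 ?exprn_ge0//.
apply: le_trans leb _.
have -> : 4 / ln 2 * (k%:R ^+ 3 * ln k%:R) =
    4 * k%:R ^+ 3 * (ln k%:R / ln 2) :> R.
  by ring.
by rewrite ler_peMr ?mulr_ge0 ?exprn_ge0// ler_pdivlMr// mul1r.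
Unshelve. all: by end_near.
Qed.
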